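(* Let $n\geq 1$ and let $k$ be an integer with $0\leq k\leq n-1$. Let $e_k^{(n)}=(a_0,\ldots,a_{n-1})\in(\mathbb{Z}/2\mathbb{Z})^n$ be the sequence with $a_k=1$ and $a_r=0$ for all $r\neq k$. Then \[ |D(e_k^{(n)})|=(k+1)(n-k). \]
   Context: For $X=(a_0,\ldots,a_{n-1})\in(\mathbb{Z}/2\mathbb{Z})^n$, the (binary) Delannoy--Steinhaus triangle $D(X)=(a_{i,j})$ is defined for $0\leq i\leq n-1$ and $0\leq j\leq n-i-1$ by $a_{0,j}=a_j$ and, in $\mathbb{Z}/2\mathbb{Z}$, \[ a_{1,j}=a_{0,j}+a_{0,j+1}\quad(0\leq j\leq n-2), \] \[ a_{i+1,j}=a_{i,j}+a_{i,j+1}+a_{i-1,j+1}\quad(1\leq i\leq n-2,\ 0\leq j\leq n-i-2). \] The weight $|D(X)|$ is the number of entries $a_{i,j}$ of the triangle (all rows, including row $0$) equal to $1$. *)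

(* Defs.v *)
From mathcomp Require Import all_boot all_algebra.

Set Implicit Arguments.
Unset Strict Implicit.
Unset Printing Implicit Defensive.

Import GRing.Theory.

(* Entry a_(i, j) of D(X).  The triangle consists of the positions with
   i + j < n; the recurrence at such a position only reads positions of the
   triangle, so the default value 0 of X`_j for j >= n is never used there.
   Values at i + j >= n are not part of D(X). *)
Fixpoint DS_entry n (X : n.-tuple 'Z_2) (i j : nat) {struct i} : 'Z_2 :=
  match i with
  | 0 => X`_j
  | 1 => X`_j + X`_j.+1
  | (i'.+1 as i1).+1 =>
      DS_entry X i1 j + DS_entry X i1 j.+1 + DS_entry X i' j.+1
  end%R.

Definition DS_weight n (X : n.-tuple 'Z_2) : nat :=
  #|[set p : 'I_n * 'I_n | (p.1 + p.2 < n) && (DS_entry X p.1 p.2 == 1%R)]|.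

Definition unit_seq (n k : nat) : n.-tuple 'Z_2 :=
  [tuple (if (i : nat) == k then 1 else 0)%R | i < n].

(* Main.v *)
Require Import Defs.
From mathcomp Require Import all_boot all_algebra zify.

(** The triangle of a unit sequence shows Delannoy numbers modulo 2.  If S is
    the shift of sequences, (S X)_j = X_(j+1), then row i is P_i(S) X,
    where P_0 = 1, P_1 = 1 + S
    and P_(i+2) = (1 + S) P_(i+1) + S P_i; the coefficients of P_i are the
    Delannoy numbers on the i-th antidiagonal.  These satisfy
    D(a, b) = D(a-1, b) + D(a, b-1) + D(a-1, b-1) with boundary values 1, hence
    they are all odd, so P_i = 1 + S + ... + S^i modulo 2.  Consequently the
    entry (i, j) of D(e_k) is 1 exactly when j <= k <= i + j
    ([DS_entry_unit_seq]).  Reading a position through its column j and its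
    antidiagonal s = i + j, the ones of the triangle are the pairs (j, s) with
    0 <= j <= k and k <= s < n: a rectangle of size k + 1 by n - k
    ([card_DS_support]). *)

Lemma addr_natb_Z2 (b c : bool) : (b%:R + c%:R = (b (+) c)%:R :> 'Z_2)%R.
Proof. by apply: val_inj; case: b; case: c. Qed.

Lemma nth_unit_seq (n k j : nat) : k < n ->
  ((unit_seq n k)`_j)%R = ((j == k)%:R : 'Z_2)%R.
Proof.
move=> lt_kn; have [lt_jn | le_nj] := ltnP j n.
  by rewrite -[j]/(val (Ordinal lt_jn)) -tnth_nth tnth_mktuple; case: eqP.
by rewrite nth_default ?size_tuple //; have -> : (j == k) = false by lia.
Qed.

(** The identity P_i = 1 + S + ... + S^i, applied to e_k.  It rests on
    1 + 1 = 0: at entry (i + 2, j) the three terms of the recurrence agree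
    (all 0 or all 1) except at k = j and k = i + j + 2, where exactly one of
    them is 1.  Extending the sequence by 0 makes it hold outside the triangle
    too, so the induction needs no bound on i + j. *)
Lemma DS_entry_unit_seq (n k i j : nat) : k < n ->
  DS_entry (unit_seq n k) i j = ((j <= k <= i + j)%:R : 'Z_2)%R.
Proof.
move=> lt_kn.
(* The recurrence has order two, so two consecutive rows are carried along. *)
suff H r : (forall c, DS_entry (unit_seq n k) r c
                        = ((c <= k <= r + c)%:R : 'Z_2)%R) /\
    (forall c, DS_entry (unit_seq n k) r.+1 c
                        = ((c <= k <= r.+1 + c)%:R : 'Z_2)%R).
  by case: (H i).
elim: r => [|r [IH0 IH1]]; split=> // c.
- by rewrite /= nth_unit_seq //; congr (_%:R)%R; lia.
- by rewrite /= !nth_unit_seq // addr_natb_Z2; congr (nat_of_bool _)%:R%R; lia.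
rewrite -[DS_entry _ _ _]/(DS_entry (unit_seq n k) r.+1 c
  + DS_entry (unit_seq n k) r.+1 c.+1 + DS_entry (unit_seq n k) r c.+1)%R.
by rewrite !IH1 IH0 !addr_natb_Z2; congr (nat_of_bool _)%:R%R; lia.
Qed.

(** In the coordinates column j and antidiagonal i + j the set is a rectangle;
    [pos] sends column u and antidiagonal k + v back to the position (i, j). *)
Lemma card_DS_support (n k : nat) : k < n ->
  #|[set p : 'I_n * 'I_n | (p.1 + p.2 < n) && (p.2 <= k <= p.1 + p.2)]|
  = k.+1 * (n - k).
Proof.
case: n => // n lt_kn.
pose pos (q : 'I_k.+1 * 'I_(n.+1 - k)) : 'I_n.+1 * 'I_n.+1 :=
  (inord (k + q.2 - q.1), inord q.1).
have pos1 q : (pos q).1 = k + q.2 - q.1 :> nat.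
  by rewrite inordK //; have := ltn_ord q.2; lia.
have pos2 q : (pos q).2 = q.1 :> nat.
  by rewrite inordK //; have := ltn_ord q.1; lia.
have pos_inj : injective pos.
  move=> q q' eq_pos.
  have := pos1 q; have := pos2 q; rewrite eq_pos pos1 pos2.
  have := ltn_ord q.1; have := ltn_ord q'.1.
  case: q q' {eq_pos} => [u v] [u' v'] /= lt_u' lt_u eq1 eq2.
  by congr (_, _); apply: val_inj => /=; lia.
rewrite -[RHS](_ : #|[set: 'I_k.+1 * 'I_(n.+1 - k)]| = _); last first.
  by rewrite cardsT card_prod !card_ord.
rewrite -(card_imset _ pos_inj); congr #|pred_of_set _|.
apply/setP=> -[i j]; rewrite inE /=; apply/idP/imsetP => [in_ij | [[u v] _ ij_q]].
  have lt_j : j < k.+1 by lia.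
  have lt_v : i + j - k < n.+1 - k by lia.
  exists (Ordinal lt_j, Ordinal lt_v); first by rewrite inE.
  by congr (_, _); apply: val_inj; rewrite /= inordK; lia.
have := pos1 (u, v); have := pos2 (u, v); rewrite -ij_q /=.
by have := ltn_ord u; have := ltn_ord v; lia.
Qed.

Theorem corollary4p3 (n k : nat) (hn : 1 <= n) (hk : k <= n - 1) :
  DS_weight (unit_seq n k) = (k + 1) * (n - k).
Proof.
have lt_kn : k < n by lia.
rewrite addn1 -card_DS_support //; apply: eq_card => p.
by rewrite !inE DS_entry_unit_seq //; case: (_ <= k <= _).
Qed.
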